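(* Let $(H,\cdot,1,\Delta,\epsilon,S,\rightharpoonup)$ be a Yetter--Drinfeld post-Hopf algebra with subadjacent Hopf algebra $H_\rightharpoonup=(H,\bullet_\rightharpoonup,1,\Delta,\epsilon,S_\rightharpoonup)$. Then $H$, with left $H_\rightharpoonup$-action $\rightharpoonup$ and left $H_\rightharpoonup$-coaction $\mathrm{Ad}_L(a)=(a_1\bullet_\rightharpoonup S_\rightharpoonup(a_3))\otimes a_2$, is a left-left Yetter--Drinfeld module over $H_\rightharpoonup$; moreover $(H,\cdot,1,\Delta,\epsilon,S)$ is a Hopf monoid in the braided monoidal category ${}^{H_\rightharpoonup}_{H_\rightharpoonup}\mathcal{YD}$ of left-left Yetter--Drinfeld modules over $H_\rightharpoonup$. The braiding on $H\otimes H$ is $a\otimes b\mapsto \alpha_\rightharpoonup(a_1)\big(\beta_\rightharpoonup(a_3)(b)\big)\otimes a_2$.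
   Context: Conventions: $\Bbbk$ is a field; algebras are associative unital, coalgebras coassociative counital; Sweedler notation $\Delta(c)=c_1\otimes c_2$ (summation omitted), iterated as $c_1\otimes c_2\otimes c_3$ etc.; $H\otimes H$ carries the tensor product coalgebra structure. Definition (Yetter--Drinfeld post-Hopf algebra). A tuple $(H,\cdot,1,\Delta,\epsilon,S,\rightharpoonup)$ where $(H,\cdot,1)$ is an algebra, $(H,\Delta,\epsilon)$ is a coalgebra on the same vector space, $S:H\to H$ is linear with $x_1\cdot S(x_2)=S(x_1)\cdot x_2=\epsilon(x)1$ for all $x$, and $\rightharpoonup:H\otimes H\to H$ is a coalgebra morphism, such that for all $x,y,z\in H$: (P1) $x\rightharpoonup(y\cdot z)=(x_1\rightharpoonup y)\cdot(x_2\rightharpoonup z)$; (P2) $x\rightharpoonup(y\rightharpoonup z)=\big(x_1\cdot(x_2\rightharpoonup y)\big)\rightharpoonup z$; (P3) the map $\alpha_\rightharpoonup:H\to\mathrm{End}(H)$, $\alpha_\rightharpoonup(x)(y)=x\rightharpoonup y$, is convolution invertible, i.e. there is $\beta_\rightharpoonup:H\to\mathrm{End}(H)$ with $\alpha_\rightharpoonup(x_1)\circ\beta_\rightharpoonup(x_2)=\beta_\rightharpoonup(x_1)\circ\alpha_\rightharpoonup(x_2)=\epsilon(x)\mathrm{Id}_H$; (P4) $\epsilon(a\cdot b)=\epsilon(a)\epsilon(b)$, $\epsilon(1)=1_\Bbbk$, $\Delta(1)=1\otimes 1$; (P5) $\Delta(x\cdot y)=\Big(x_1\cdot\alpha_\rightharpoonup(x_2)\big(\beta_\rightharpoonup(x_4)(y_1)\big)\Big)\otimes(x_3\cdot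 y_2)$; (P6) setting $x\bullet_\rightharpoonup y:=x_1\cdot(x_2\rightharpoonup y)$, $S_\rightharpoonup(x):=\beta_\rightharpoonup(x_1)(S(x_2))$ and $x\leftharpoonup y:=\big(S_\rightharpoonup(x_1\rightharpoonup y_1)\bullet_\rightharpoonup x_2\big)\bullet_\rightharpoonup y_2$, one has $\Delta(S_\rightharpoonup(x))=S_\rightharpoonup(x_2)\otimes S_\rightharpoonup(x_1)$ and $(x_1\rightharpoonup y_1)\otimes(x_2\leftharpoonup y_2)=(x_2\rightharpoonup y_2)\otimes(x_1\leftharpoonup y_1)$. Fact: $H_\rightharpoonup=(H,\bullet_\rightharpoonup,1,\Delta,\epsilon,S_\rightharpoonup)$ is a Hopf algebra (the subadjacent Hopf algebra). Yetter--Drinfeld modules: for a Hopf algebra $A$ with antipode $T$, a left-left Yetter--Drinfeld module is a left $A$-module $(V,\triangleright)$ and left $A$-comodule $\rho(v)=v_{-1}\otimes v_0$ with $\rho(a\triangleright v)=a_1v_{-1}T(a_3)\otimes a_2\triangleright v_0$; these form the braided monoidal category ${}^A_A\mathcal{YD}$ (diagonal action and coaction on tensor products) with braiding $\sigma(v\otimes w)=v_{-1}\triangleright w\otimes v_0$. A bimonoid in ${}^A_A\mathcal{YD}$ is an object $K$ with algebra $(m,u)$ and coalgebra $(\Delta,\epsilon)$ structures whose structure maps are module and comodule morphisms, with $\epsilon$ and $u$ compatible ($\epsilon$ multiplicative, $\epsilon(1)=1$, $\Delta(1)=1\otimes1$) and $\Delta\circ m=(m\otimes m)(\mathrm{Id}\otimes\sigma\otimes\mathrm{Id})(\Delta\otimes\Delta)$;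 it is a Hopf monoid if moreover $\mathrm{Id}_K$ has a convolution inverse $S_K$ (the antipode). *)

(* Defs.v *)
From HB Require Import structures.
From mathcomp Require Import all_boot all_algebra.
Set Implicit Arguments. Unset Strict Implicit. Unset Printing Implicit Defensive.
Import GRing.Theory.
Local Open Scope ring_scope.

(* Tensor products are not available in MathComp.  An element of H (x) H
   (resp. H (x) H (x) H) is represented by a finite formal sum of simple
   tensors, i.e. a list of pairs (resp. triples); two such formal sums are
   equal in the tensor product iff they have the same image under every
   multilinear map into every K-vector space (universal property). *)

Section Defs.
Variables (K : fieldType) (H : lmodType K).

Definition linmap (f : H -> H) :=
  forall (a : K) u v, f (a *: u + v) = a *: f u + f v.
Definition linform (f : H -> K) :=
  forall (a : K) u v, f (a *: u + v) = a * f u + f v.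

Definition bilin (W : lmodType K) (f : H -> H -> W) :=
  (forall y (a : K) u v, f (a *: u + v) y = a *: f u y + f v y) /\
  (forall x (a : K) u v, f x (a *: u + v) = a *: f x u + f x v).

Definition trilin (W : lmodType K) (f : H -> H -> H -> W) :=
  [/\ (forall y z (a : K) u v, f (a *: u + v) y z = a *: f u y z + f v y z),
      (forall x z (a : K) u v, f x (a *: u + v) z = a *: f x u z + f x v z) &
      (forall x y (a : K) u v, f x y (a *: u + v) = a *: f x y u + f x y v)].

Definition teq2 (s t : seq (H * H)) : Prop :=
  forall (W : lmodType K) (f : H -> H -> W), bilin f ->
    \sum_(p <- s) f p.1 p.2 = \sum_(p <- t) f p.1 p.2.

Definition teq3 (s t : seq (H * H * H)) : Prop :=
  forall (W : lmodType K) (f : H -> H -> H -> W), trilin f ->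
    \sum_(p <- s) f p.1.1 p.1.2 p.2 = \sum_(p <- t) f p.1.1 p.1.2 p.2.

Definition tscale2 (a : K) (s : seq (H * H)) := [seq (a *: p.1, p.2) | p <- s].

(* Sweedler notation: x1 (x) x2 (x) x3 = (Delta (x) id) Delta x, and
   x1 (x) x2 (x) x3 (x) x4 = (Delta (x) id (x) id)(Delta (x) id) Delta x *)
Definition sw3 (D : H -> seq (H * H)) (x : H) : seq (H * H * H) :=
  [seq (q.1, q.2, p.2) | p <- D x, q <- D p.1].
Definition sw4 (D : H -> seq (H * H)) (x : H) : seq (H * H * H * H) :=
  [seq (t.1.1, t.1.2, t.2, p.2) | p <- D x, t <- sw3 D p.1].

Definition coalgebra (D : H -> seq (H * H)) (eps : H -> K) :=
  [/\ forall (a : K) u v, teq2 (D (a *: u + v)) (tscale2 a (D u) ++ D v),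
      linform eps,
      forall x, teq3 (sw3 D x) [seq (p.1, q.1, q.2) | p <- D x, q <- D p.2],
      forall x, \sum_(p <- D x) eps p.1 *: p.2 = x &
      forall x, \sum_(p <- D x) eps p.2 *: p.1 = x].

Definition yd_module (mA : H -> H -> H) (uA : H) (DA : H -> seq (H * H))
    (epsA : H -> K) (SA : H -> H) (act : H -> H -> H) (rho : H -> seq (H * H)) :=
  [/\
      [/\ bilin act,
          (forall h g v, act (mA h g) v = act h (act g v)) &
          (forall v, act uA v = v)],
      [/\ (forall (a : K) u v, teq2 (rho (a *: u + v)) (tscale2 a (rho u) ++ rho v)),
      (forall v, teq3 [seq (q.1, q.2, r.2) | r <- rho v, q <- DA r.1]
                      [seq (r.1, q.1, q.2) | r <- rho v, q <- rho r.2]) &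
      (forall v, \sum_(r <- rho v) epsA r.1 *: r.2 = v)] &
      (forall h v, teq2 (rho (act h v))
         [seq (mA (mA p.1.1 r.1) (SA p.2), act p.1.2 r.2) | p <- sw3 DA h, r <- rho v])].

Definition braiding (act : H -> H -> H) (rho : H -> seq (H * H)) (v w : H) :=
  [seq (act r.1 w, r.2) | r <- rho v].

(* (H, m, u, D, eps, S) is a Hopf monoid in the braided monoidal category of
   left-left YD modules over (H, mA, uA, DA, epsA, SA) with action act and
   coaction rho (tensor products carry diagonal action/coaction). *)
Definition yd_hopf_monoid (mA : H -> H -> H) (uA : H) (DA : H -> seq (H * H))
    (epsA : H -> K) (SA : H -> H) (act : H -> H -> H) (rho : H -> seq (H * H))
    (m : H -> H -> H) (u : H) (D : H -> seq (H * H)) (eps : H -> K) (S : H -> H) :=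
  [/\
      [/\ bilin m, associative m, left_id u m & right_id u m],
      coalgebra D eps,
      [/\ (forall h a b, act h (m a b) = \sum_(p <- DA h) m (act p.1 a) (act p.2 b)),
          (forall h, act h u = epsA h *: u),
          (forall h a, teq2 (D (act h a))
                            [seq (act p.1 q.1, act p.2 q.2) | p <- DA h, q <- D a]) &
          (forall h a, eps (act h a) = epsA h * eps a)],
      [/\ (forall a b, teq2 (rho (m a b))
                            [seq (mA r.1 s.1, m r.2 s.2) | r <- rho a, s <- rho b]),
          teq2 (rho u) [:: (uA, u)],
          (forall a, teq3 [seq (r.1, q.1, q.2) | r <- rho a, q <- D r.2]
                          (flatten [seq [seq (mA r.1 s.1, r.2, s.2) | r <- rho p.1, s <- rho p.2] | p <- D a])) &
          (forall a, \sum_(r <- rho a) eps r.2 *: r.1 = eps a *: uA)] &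
      [/\ (forall a b, eps (m a b) = eps a * eps b), eps u = 1,
          teq2 (D u) [:: (u, u)] &
          (forall a b, teq2 (D (m a b))
             (flatten [seq [seq (m p.1 r.1, m r.2 q.2) | q <- D b, r <- braiding act rho p.2 q.1] | p <- D a]))] /\
      [/\ linmap S,
          (forall h a, S (act h a) = act h (S a)),
          (forall a, teq2 (rho (S a)) [seq (r.1, S r.2) | r <- rho a]),
          (forall x, \sum_(p <- D x) m p.1 (S p.2) = eps x *: u) &
          (forall x, \sum_(p <- D x) m (S p.1) p.2 = eps x *: u)]].

End Defs.

Section PostHopf.
Variables (K : fieldType) (H : algType K).
Variables (D : H -> seq (H * H)) (eps : H -> K) (S : H -> H) (harp beta : H -> H -> H).

Definition bullet (x y : H) : H := \sum_(p <- D x) p.1 * harp p.2 y.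
Definition Sharp (x : H) : H := \sum_(p <- D x) beta p.1 (S p.2).
Definition lharp (x y : H) : H :=
  \sum_(p <- D x) \sum_(q <- D y) bullet (bullet (Sharp (harp p.1 q.1)) p.2) q.2.
Definition AdL (a : H) : seq (H * H) :=
  [seq (bullet p.1.1 (Sharp p.2), p.1.2) | p <- sw3 D a].

Definition yd_post_hopf :=
  [/\
      coalgebra D eps,
      [/\ linmap S,
          (forall x, \sum_(p <- D x) p.1 * S p.2 = eps x *: 1) &
          (forall x, \sum_(p <- D x) S p.1 * p.2 = eps x *: 1)],
      [/\ bilin harp,
          (forall x y, teq2 (D (harp x y)) [seq (harp p.1 q.1, harp p.2 q.2) | p <- D x, q <- D y]) &
          (forall x y, eps (harp x y) = eps x * eps y)],
      [/\ (forall x y z, harp x (y * z) = \sum_(p <- D x) harp p.1 y * harp p.2 z),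
      (forall x y z, harp x (harp y z) = harp (bullet x y) z) &
      [/\ bilin beta,
          (forall x y, \sum_(p <- D x) harp p.1 (beta p.2 y) = eps x *: y) &
          (forall x y, \sum_(p <- D x) beta p.1 (harp p.2 y) = eps x *: y)]] &
      [/\ [/\ (forall a b, eps (a * b) = eps a * eps b), eps 1 = 1 & teq2 (D 1) [:: (1, 1)]],
      (forall x y, teq2 (D (x * y))
         [seq (r.1.1.1 * harp r.1.1.2 (beta r.2 q.1), r.1.2 * q.2) | r <- sw4 D x, q <- D y]) &
      ((forall x, teq2 (D (Sharp x)) [seq (Sharp p.2, Sharp p.1) | p <- D x]) /\
      (forall x y, teq2 [seq (harp p.1 q.1, lharp p.2 q.2) | p <- D x, q <- D y]
                        [seq (harp p.2 q.2, lharp p.1 q.1) | p <- D x, q <- D y]))]].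

End PostHopf.

(* Main.v *)
Require Import Defs.
From mathcomp Require Import all_boot all_algebra.
Set Implicit Arguments. Unset Strict Implicit. Unset Printing Implicit Defensive.
Import GRing.Theory.
Local Open Scope ring_scope.

(** Write [x |> y] for the action, [x ** y] = [x_1 (x_2 |> y)] for the subadjacent
    product and [T] for its antipode.  From (P5), [**] is comultiplicative.  The map
    [T] is a right convolution inverse of the identity; hence [beta x y = T x |> y],
    and since [T] is anticomultiplicative,
      [T x_1 ** x_2 = (T x_2) (T x_1 |> x_3) = T x_1 |> (S x_2 x_3) = eps x].
    The definition of [<|] gives [x ** y = (x_1 |> y_1) ** (x_2 <| y_2)], so the
    commutation in (P6) of [|>] with [<|] turns
      [(h_1 ** v_1) ** T (h_3 ** v_3) (x) h_2 |> v_2]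
    into [(h_1 |> v_1) ** T (h_3 |> v_3) (x) h_2 |> v_2], the Yetter-Drinfeld
    compatibility.  The coaction is multiplicative because
    [x y = x_1 ** (T x_2 |> y)], (P5) is the braided multiplicativity of [Delta], and
    [S] is a morphism because it is a convolution inverse of one. *)

(** * Multilinear calculus of Sweedler sums *)

Section Sweedler.
Variables (K : fieldType) (H : lmodType K).

Definition lin (V W : lmodType K) (f : V -> W) :=
  forall (a : K) u v, f (a *: u + v) = a *: f u + f v.

(* Sweedler sum [F x_1 x_2]; identities in a tensor product become identities between
   such sums, for [F] an arbitrary multilinear map. *)
Definition sw (W : lmodType K) (D : H -> seq (H * H)) (x : H) (F : H -> H -> W) : W :=
  \sum_(p <- D x) F p.1 p.2.

Definition lincomul (D : H -> seq (H * H)) :=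
  forall (a : K) u v, teq2 (D (a *: u + v)) (tscale2 a (D u) ++ D v).

Lemma linZ (V W : lmodType K) (f : V -> W) (a : K) u : lin f -> f (a *: u) = a *: f u.
Proof.
move=> lf; have f0 : f 0 = 0.
  by have := lf 1 0 0; rewrite !scale1r addr0 => /(congr1 (+%R^~ (- f 0))); rewrite subrr addrK.
by have := lf a u 0; rewrite f0 !addr0.
Qed.

Lemma lin_sum (V W : lmodType K) (f : V -> W) (I : Type) (r : seq I) (F : I -> V) :
  lin f -> f (\sum_(i <- r) F i) = \sum_(i <- r) f (F i).
Proof.
move=> lf; elim: r => [|i r IHr]; first by rewrite !big_nil -(scale0r 0) linZ // !scale0r.
by rewrite !big_cons -IHr -[X in f (X + _)]scale1r lf scale1r.
Qed.

Lemma lin_sw (V W : lmodType K) (f : V -> W) D x F :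
  lin f -> f (sw D x F) = sw D x (fun a b => f (F a b)).
Proof. exact: lin_sum. Qed.

Lemma eq_sw (W : lmodType K) D x (F G : H -> H -> W) :
  (forall a b, F a b = G a b) -> sw D x F = sw D x G.
Proof. by move=> eqFG; apply: eq_bigr => p _. Qed.

Lemma sw_exchange (W : lmodType K) D D' x y (F : H -> H -> H -> H -> W) :
  sw D x (fun a b => sw D' y (F a b)) = sw D' y (fun c d => sw D x (fun a b => F a b c d)).
Proof. exact: exchange_big. Qed.

Lemma lin_id (V : lmodType K) : lin (fun x : V => x).
Proof. by []. Qed.

Lemma lin_comp (U V W : lmodType K) (f : V -> W) (g : U -> V) :
  lin f -> lin g -> lin (fun x => f (g x)).
Proof. by move=> lf lg a u v; rewrite lg lf. Qed.

Lemma lin_scale (V W : lmodType K) (a : K) (f : V -> W) : lin f -> lin (fun x => a *: f x).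
Proof. by move=> lf b u v; rewrite lf scalerDr !scalerA mulrC. Qed.


Lemma lin_form (V W : lmodType K) (e : H -> K) (g : V -> H) (w : W) :
  linform e -> lin g -> lin (fun x => e (g x) *: w).
Proof. by move=> le lg a u v; rewrite lg le scalerDl scalerA. Qed.

Lemma lin_inner (V W : lmodType K) D x (F : V -> H -> H -> W) :
  (forall a b, lin (fun v => F v a b)) -> lin (fun v => sw D x (F v)).
Proof.
move=> lF a u v; rewrite /sw scaler_sumr -big_split /=.
by apply: eq_bigr => p _; rewrite lF.
Qed.

Lemma bilinI (W : lmodType K) (F : H -> H -> W) :
  (forall b, lin (fun a => F a b)) -> (forall a, lin (fun b => F a b)) -> bilin F.
Proof. by move=> *; split. Qed.

Lemma trilinI (W : lmodType K) (F : H -> H -> H -> W) :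
  (forall b c, lin (fun a => F a b c)) -> (forall a c, lin (fun b => F a b c)) ->
  (forall a b, lin (fun c => F a b c)) -> trilin F.
Proof. by move=> *; split. Qed.

Lemma lin_bilinl (V W : lmodType K) (F : H -> H -> W) (g : V -> H) y :
  bilin F -> lin g -> lin (fun x => F (g x) y).
Proof. by case=> lF _; apply: lin_comp (lF y). Qed.

Lemma lin_bilinr (V W : lmodType K) (F : H -> H -> W) (g : V -> H) y :
  bilin F -> lin g -> lin (fun x => F y (g x)).
Proof. by case=> _ lF; apply: lin_comp (lF y). Qed.

Lemma lin_trilin1 (V W : lmodType K) (F : H -> H -> H -> W) (g : V -> H) y z :
  trilin F -> lin g -> lin (fun x => F (g x) y z).
Proof. by case=> lF _ _; apply: lin_comp (lF y z). Qed.

Lemma lin_trilin2 (V W : lmodType K) (F : H -> H -> H -> W) (g : V -> H) y z :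
  trilin F -> lin g -> lin (fun x => F y (g x) z).
Proof. by case=> _ lF _; apply: lin_comp (lF y z). Qed.

Lemma lin_trilin3 (V W : lmodType K) (F : H -> H -> H -> W) (g : V -> H) y z :
  trilin F -> lin g -> lin (fun x => F y z (g x)).
Proof. by case=> _ _ lF; apply: lin_comp (lF y z). Qed.

(** As a formal sum [D x] is not additive in [x]; only its images under bilinear maps are. Hence
    linearity in the comultiplied element rests on [lincomul] and on bilinearity of the summand
    together. *)
Lemma lin_outer (V W : lmodType K) D (g : V -> H) (F : H -> H -> W) :
  lincomul D -> bilin F -> lin g -> lin (fun x => sw D (g x) F).
Proof.
move=> lD bF lg; apply: (lin_comp (f := fun x => sw D x F)) lg => a u v.
rewrite /sw (lD a u v _ _ bF) big_cat big_map /= scaler_sumr; congr (_ + _).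
by apply: eq_bigr => p _; apply: (linZ (f := F^~ p.2)) => b w w'; apply: bF.1.
Qed.

End Sweedler.

Create HintDb multilinear.

(* Proves multilinearity one argument at a time, by recursion on the expression. *)
Ltac multilin := cbv beta;
  lazymatch goal with
  | |- forall _, _ => intro; multilin
  | |- bilin _ => first [ solve [auto with multilinear nocore] | apply: bilinI => ?; multilin ]
  | |- trilin _ => first [ assumption | apply: trilinI => ? ?; multilin ]
  | |- lin (fun x => x) => exact: lin_id
  | |- lin id => exact: lin_id
  | |- lin (fun x => _ *: _) =>
      first [ apply: lin_scale; multilin
            | apply: lin_form; [ solve [auto with multilinear nocore] | multilin ] ]
  | |- lin (fun x => sw _ _ _) =>
      first [ apply: lin_outer; [ solve [auto with multilinear nocore] | multilin | multilin ]
            | apply: lin_inner => ? ?; multilin ]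
  | |- lin (fun x => @?f x) =>
     first [ assumption
     | match goal with
       | |- lin (fun x => ?F (@?g x) ?y ?z) =>
         apply: (@lin_trilin1 _ _ _ _ F g y z); [ assumption | multilin ]
       | |- lin (fun x => ?F ?y (@?g x) ?z) => apply: (@lin_trilin2 _ _ _ _ F g y z); [ assumption | multilin ]
       | |- lin (fun x => ?F ?y ?z (@?g x)) =>
         apply: (@lin_trilin3 _ _ _ _ F g y z); [ assumption | multilin ]
       | |- lin (fun x => ?F (@?g x) ?y) =>
         apply: (@lin_bilinl _ _ _ _ F g y); [ solve [auto with multilinear nocore] | multilin ]
       | |- lin (fun x => ?F ?y (@?g x)) =>
         apply: (@lin_bilinr _ _ _ _ F g y); [ solve [auto with multilinear nocore] | multilin ]
       | |- lin (fun x => ?F (@?g x)) =>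
         apply: (@lin_comp _ _ _ _ F g); [ solve [auto with multilinear nocore] | multilin ]
       end ]
  | |- lin ?f => change (lin (fun x => f x)); multilin
  end.

#[local] Hint Extern 0 (lin _) => multilin : core.
#[local] Hint Extern 0 (bilin _) => multilin : core.
#[local] Hint Extern 0 (trilin _) => multilin : core.

(* [sw tac] (resp. [swi tac]) applies the equation provided by [tac] to the left-hand side
   below the fewest (resp. the most) leading [sw] binders possible. *)
Ltac at_sw tac :=
  first [ tac | etransitivity; [ apply: eq_sw => ? ?; at_sw tac; reflexivity | ] ].
Tactic Notation "sw" tactic3(tac) :=
  at_sw ltac:(etransitivity; [ tac; multilin | ]); cbv beta.

Ltac in_sw tac :=
  first [ etransitivity; [ apply: eq_sw => ? ?; in_sw tac; reflexivity | ] | tac ].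
Tactic Notation "swi" tactic3(tac) :=
  in_sw ltac:(etransitivity; [ tac; multilin | ]); cbv beta.

(** * Coassociativity, counit and cancellation inside Sweedler sums *)

Section Coalgebra.
Variables (K : fieldType) (H : lmodType K) (D : H -> seq (H * H)) (eps : H -> K).
Hypothesis coalgD : coalgebra D eps.
Local Notation "\D_ ( i , j <- x ) E" := (sw D x (fun i => fun j => E))
  (at level 41, E at level 41, i name, j name, x at level 50,
   format "'[' \D_ ( i ,  j  <-  x ) '/  '  E ']'").

Lemma coalgebra_lincomul : lincomul D.
Proof. by case: coalgD. Qed.

Lemma coalgebra_linform : linform eps.
Proof. by case: coalgD. Qed.
#[local] Hint Resolve coalgebra_lincomul coalgebra_linform : multilinear.

Lemma coassoc (W : lmodType K) x (F : H -> H -> H -> W) : trilin F ->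
  \D_(a, b <- x) \D_(c, d <- a) F c d b = \D_(a, b <- x) \D_(c, d <- b) F a c d.
Proof.
by case: coalgD => _ _ coD _ _ tF; have := coD x W F tF; rewrite !big_allpairs_dep.
Qed.

Lemma counitl (W : lmodType K) x (F : H -> W) : lin F ->
  \D_(a, b <- x) eps a *: F b = F x.
Proof.
case: coalgD => _ _ _ eD _ lF; rewrite -[in RHS](eD x) lin_sum //.
by apply: eq_bigr => p _; rewrite linZ.
Qed.

Lemma counitr (W : lmodType K) x (F : H -> W) : lin F ->
  \D_(a, b <- x) eps b *: F a = F x.
Proof.
case: coalgD => _ _ _ _ eD lF; rewrite -[in RHS](eD x) lin_sum //.
by apply: eq_bigr => p _; rewrite linZ.
Qed.

(** Common pattern of later cancellations: two adjacent Sweedler factors that convolve to the counit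
    are regrouped, replaced by [Q], and the remaining [eps] is absorbed by the counit axiom. *)
Lemma cancel_front (W : lmodType K) (P : H -> H -> H) (Q : H) x (G : H -> H -> W) :
  bilin P -> (forall y, \D_(a, b <- y) P a b = eps y *: Q) -> bilin G ->
  \D_(a, r <- x) \D_(b, c <- r) G (P a b) c = G Q x.
Proof.
move=> bP PQ bG.
rewrite -(coassoc x (F := fun a b c => G (P a b) c)) //.
under eq_sw => u c.
  rewrite -(lin_sw (f := G^~ c)) //.
  rewrite PQ (linZ (f := G^~ c)) //.
  over.
by apply: counitl; multilin.
Qed.

Lemma cancel_end (W : lmodType K) (P : H -> H -> H) (Q : H) x (G : H -> H -> W) :
  bilin P -> (forall y, \D_(a, b <- y) P a b = eps y *: Q) -> bilin G ->
  \D_(c, r <- x) \D_(a, b <- r) G c (P a b) = G x Q.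
Proof.
move=> bP PQ bG.
under eq_sw => c r.
  rewrite -(lin_sw (f := G c)) //.
  rewrite PQ (linZ (f := G c)) //.
  over.
by apply: (@counitr _ x (G^~ Q)); multilin.
Qed.
End Coalgebra.

(** * The axioms as rewriting rules for Sweedler sums *)

Section PostHopf.
Variables (K : fieldType) (H : algType K).
Variables (D : H -> seq (H * H)) (eps : H -> K) (S : H -> H) (harp beta : H -> H -> H).
Hypothesis postH : yd_post_hopf D eps S harp beta.

Local Notation "\D_ ( i , j <- x ) E" := (sw D x (fun i => fun j => E))
  (at level 41, E at level 41, i name, j name, x at level 50,
   format "'[' \D_ ( i ,  j  <-  x ) '/  '  E ']'").
Local Notation "\DD_ ( i , k ; j , l <- x , y ) E" :=
  (sw D x (fun i => fun j => sw D y (fun k => fun l => E)))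
  (at level 41, E at level 41, i name, j name, k name, l name,
   x at level 50, y at level 50,
   format "'[' \DD_ ( i ,  k ;  j ,  l  <-  x ,  y ) '/  '  E ']'").
Local Notation "x |> y" := (harp x y) (at level 38, right associativity).
Local Notation "x ** y" := (bullet D harp x y) (at level 40, left associativity).
Local Notation "x <| y" := (lharp D S harp beta x y) (at level 38, right associativity).
Local Notation T := (Sharp D S beta).
Local Notation Ad := (AdL D S harp beta).

Lemma coalgD : coalgebra D eps.
Proof. by case: postH. Qed.

Let lincomulD := coalgebra_lincomul coalgD.
Let linform_eps := coalgebra_linform coalgD.

Lemma lin_antipode : lin S.
Proof. by case: postH => _ [lS _ _]. Qed.

Lemma bilin_harp : bilin harp.
Proof. by case: postH => _ _ []. Qed.

Lemma bilin_beta : bilin beta.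
Proof. by case: postH => _ _ _ [_ _ []]. Qed.

Lemma bilin_mul : bilin (@GRing.mul H).
Proof.
by split=> *; [rewrite mulrDl -scalerAl | rewrite mulrDr -scalerAr].
Qed.
#[local] Hint Resolve lincomulD linform_eps lin_antipode : multilinear.
#[local] Hint Resolve bilin_harp bilin_beta bilin_mul : multilinear.

Lemma mul_antipode x : \D_(a, b <- x) a * S b = eps x *: 1.
Proof. by case: postH => _ [_ h _] *; apply: h. Qed.

Lemma antipode_mul x : \D_(a, b <- x) S a * b = eps x *: 1.
Proof. by case: postH => _ [_ _ h] *; apply: h. Qed.

Lemma sw_harp (W : lmodType K) x y (F : H -> H -> W) : bilin F ->
  sw D (x |> y) F = \D_(a, b <- x) \D_(c, d <- y) F (a |> c) (b |> d).
Proof.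
case: postH => _ _ [_ h _] _ _ bF.
by have := h x y W F bF; rewrite big_allpairs_dep.
Qed.

Lemma eps_harp x y : eps (x |> y) = eps x * eps y.
Proof. by case: postH => _ _ [_ _ h] *. Qed.

Lemma harpM x y z : x |> (y * z) = \D_(a, b <- x) (a |> y) * (b |> z).
Proof. by case: postH => _ _ _ [h _ _] *; apply: h. Qed.

Lemma harp_harp x y z : x |> y |> z = (x ** y) |> z.
Proof. by case: postH => _ _ _ [_ h _] *; apply: h. Qed.

Lemma harp_betaK x y : \D_(a, b <- x) a |> beta b y = eps x *: y.
Proof. by case: postH => _ _ _ [_ _ [_ h _]] _; apply: h. Qed.

Lemma beta_harpK x y : \D_(a, b <- x) beta a (b |> y) = eps x *: y.
Proof. by case: postH => _ _ _ [_ _ [_ _ h]] _; apply: h. Qed.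

Lemma epsM x y : eps (x * y) = eps x * eps y.
Proof. by case: postH => _ _ _ _ [[h _ _] *]; apply: h. Qed.

Lemma eps1 : eps 1 = 1.
Proof. by case: postH => _ _ _ _ [[_ h _] *]. Qed.

Lemma sw1 (W : lmodType K) (F : H -> H -> W) : bilin F -> sw D 1 F = F 1 1.
Proof.
by case: postH => _ _ _ _ [[_ _ h] _ _] bF; have := h W F bF; rewrite big_seq1.
Qed.

Lemma sw_mul (W : lmodType K) x y (F : H -> H -> W) : bilin F ->
  sw D (x * y) F = \D_(a, r <- x) \D_(b, s <- r) \D_(c, d <- s) \D_(e, f <- y)
    F (a * (b |> beta d e)) (c * f).
Proof.
case: postH => _ _ _ _ [_ h _] bF.
rewrite [LHS](h x y W F bF) big_allpairs_dep big_allpairs_dep.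
under eq_bigr => p _ do rewrite big_allpairs_dep.
rewrite -/(\D_(u, v <- x) \D_(w, c <- u) \D_(a, b <- w) \D_(e, f <- y)
  F (a * (b |> beta v e)) (c * f)).
swi (apply: (coassoc coalgD)).
swi (apply: (coassoc coalgD)).
by swi (apply: (coassoc coalgD)).
Qed.

Lemma sw_sharp (W : lmodType K) x (F : H -> H -> W) : bilin F ->
  sw D (T x) F = \D_(a, b <- x) F (T b) (T a).
Proof.
case: postH => _ _ _ _ [_ _ [h _]] bF.
by have := h x W F bF; rewrite big_map.
Qed.

Lemma sw_harp_lharp (W : lmodType K) x y (F : H -> H -> W) : bilin F ->
  \D_(a, b <- x) \D_(c, d <- y) F (a |> c) (lharp D S harp beta b d) =
  \D_(a, b <- x) \D_(c, d <- y) F (b |> d) (lharp D S harp beta a c).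
Proof.
case: postH => _ _ _ _ [_ _ [_ h]] bF.
by have := h x y W F bF; rewrite !big_allpairs_dep.
Qed.

(** * The subadjacent product: unit, comultiplicativity, associativity *)

Lemma bilin_bullet : bilin (bullet D harp).
Proof. by rewrite -[bullet D harp]/(fun x y => \D_(a, b <- x) a * (b |> y)); multilin. Qed.

Lemma lin_sharp : lin T.
Proof. by rewrite -[Sharp D S beta]/(fun x => \D_(a, b <- x) beta a (S b)); multilin. Qed.
#[local] Hint Resolve bilin_bullet lin_sharp : multilinear.

(** As [1] is grouplike, [1 |> _] is multiplicative with two-sided inverse [beta 1], so it fixes
    [1]. Then [1 ** 1 = 1] and (P2) makes it idempotent, and an invertible idempotent is the
    identity. *)
Lemma harp1x y : 1 |> y = y.
Proof.
have b1K z : beta 1 (1 |> z) = z.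
  by have := beta_harpK 1 z; rewrite eps1 scale1r sw1 //; multilin.
have h1K z : 1 |> beta 1 z = z.
  by have := harp_betaK 1 z; rewrite eps1 scale1r sw1 //; multilin.
have h1M z t : 1 |> (z * t) = (1 |> z) * (1 |> t) by rewrite harpM sw1 //; multilin.
have h11 : 1 |> 1 = 1 by rewrite -[LHS]mulr1 -{3}(h1K 1) -h1M mul1r h1K.
have h11K z : 1 |> 1 |> z = 1 |> z.
  rewrite harp_harp -[1 ** 1]/(\D_(a, b <- 1) a * (b |> 1)) sw1 //.
  by rewrite h11 mulr1.
by rewrite -[LHS]b1K h11K b1K.
Qed.


Lemma harp_beta_end (W : lmodType K) x y (G : H -> H -> W) : bilin G ->
  \D_(c, r <- x) \D_(a, b <- r) G c (a |> beta b y) = G x y.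
Proof.
apply: (@cancel_end _ _ _ _ coalgD _ (fun a b => a |> beta b y)); first multilin.
by move=> z; apply: harp_betaK.
Qed.

Lemma beta_harp_front (W : lmodType K) x y (G : H -> H -> H -> W) : trilin G ->
  \D_(a, r <- x) \D_(b, c <- r) \D_(p, q <- y) G (beta a (b |> p)) c q =
  \D_(p, q <- y) G p x q.
Proof.
move=> tG; under eq_sw => a r do rewrite sw_exchange.
rewrite sw_exchange; apply: eq_sw => p q.
apply: (@cancel_front _ _ _ _ coalgD _ (fun a b => beta a (b |> p)) p x (fun u c => G u c q));
  try multilin.
by move=> z; apply: beta_harpK.
Qed.

Lemma lin_bullet (W : lmodType K) (f : H -> W) x y : lin f ->
  f (x ** y) = \D_(a, b <- x) f (a * (b |> y)).
Proof. exact: lin_sw. Qed.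

(** Write [eps x 1 = x_1 |> beta x_2 1] and insert [beta x_2 1 = 1 * beta x_2 1]: by (P1) this is
    [(x_1 |> 1) (x_2 |> beta x_3 1)], where (P3) cancels the second factor. *)
Lemma harpx1 x : x |> 1 = eps x *: 1.
Proof.
rewrite -harp_betaK; symmetry.
under eq_sw => a b do rewrite -[beta b 1]mul1r harpM.
sw (apply: (@coassoc _ _ _ _ coalgD _ _ (fun a b c => (a |> 1) * (b |> beta c 1)))).
rewrite -[RHS]mulr1.
by sw (apply: (harp_beta_end _ _ (G := fun c u => (c |> 1) * u))).
Qed.

(** Applied to [x_1 (x_2 |> y)], (P5) gives [x_1 (x_2 |> beta x_4 (x_5 |> y_1)) (x) x_3 (x_6 |>
    y_2)]. The pair [x_4], [x_5] cancels by (P3), and with it the twist of (P5). *)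
Lemma sw_bullet (W : lmodType K) x y (F : H -> H -> W) : bilin F ->
  sw D (x ** y) F = \D_(a, b <- x) \D_(c, d <- y) F (a ** c) (b ** d).
Proof.
move=> bF.
sw (apply: (lin_bullet (f := fun z => sw D z F))).
sw (apply: sw_mul).
swi (apply: sw_harp).
do 3!sw (apply: (coassoc coalgD)).
symmetry.
swi (apply: (lin_bullet (f := F^~ _))).
swi (apply: sw_exchange).
swi (apply: (lin_bullet (f := F _))).
swi (apply: sw_exchange).
sw (apply: (coassoc coalgD)).
apply: eq_sw => a r; apply: eq_sw => b s; symmetry.
transitivity (\D_(c, t <- s) \D_(p, q <- y) F (a * (b |> p)) (c * (t |> q))) => //.
apply: eq_sw => c t.
by apply: (@beta_harp_front _ _ _ (fun u v w => F (a * (b |> u)) (c * (v |> w)))); multilin.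
Qed.

Lemma eps_bullet x y : eps (x ** y) = eps x * eps y.
Proof.
have lf : lin (V := H) (W := K^o) eps by exact: linform_eps.
rewrite (lin_bullet _ _ lf); under eq_sw => a b do rewrite epsM eps_harp mulrCA.
apply: (@counitr _ _ _ _ coalgD K^o x (fun a => eps a * eps y)).
by move=> a u v; rewrite linform_eps mulrDl -mulrA.
Qed.

Lemma bulletx1 : right_id 1 (bullet D harp).
Proof.
move=> x; rewrite (lin_bullet (f := id)) //.
under eq_sw => a b do rewrite harpx1 -scalerAr mulr1.
by apply: (counitr coalgD).
Qed.

Lemma bullet1x : left_id 1 (bullet D harp).
Proof.
by move=> x; rewrite (lin_bullet (f := id)) // sw1 ?mul1r ?harp1x //; multilin.
Qed.

(** Both bracketings equal [x_1 (x_2 |> y_1) (x_3 |> y_2 |> z)]: [x ** (y ** z)] by (P1),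
    [(x ** y) ** z] by comultiplicativity of [**] and (P2). *)
Lemma bulletA : associative (bullet D harp).
Proof.
move=> x y z.
symmetry; rewrite [LHS](lin_bullet (f := id)) // sw_bullet //.
under eq_sw => a b do under eq_sw => c d do rewrite -harp_harp.
swi (apply: (lin_bullet (f := fun u => u * (_ |> _ |> z)))).
swi (apply: sw_exchange).
sw (apply: (coassoc coalgD)).
symmetry; rewrite [LHS](lin_bullet (f := id)) //.
apply: eq_sw => a b; rewrite (lin_bullet (f := harp b)) //.
rewrite (lin_sw (f := *%R a)) //.
rewrite sw_exchange; apply: eq_sw => c d.
rewrite harpM (lin_sw (f := *%R a)) //.
by apply: eq_sw => e f; rewrite mulrA.
Qed.

(** * The antipode of the subadjacent Hopf algebra *)

Lemma lin_sharpE (W : lmodType K) (f : H -> W) x : lin f ->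
  f (T x) = \D_(a, b <- x) f (beta a (S b)).
Proof. exact: lin_sw. Qed.

(** Unlike in [cancel_front], the cancelling pair acts on a value that depends on the third Sweedler
    factor. *)
Lemma harp_beta_lin (W : lmodType K) x (f : H -> H) (g : H -> W) : lin f -> lin g ->
  \D_(a, r <- x) \D_(b, c <- r) g (a |> beta b (f c)) = g (f x).
Proof.
move=> lf lg; have lgf : lin (fun c => g (f c)) by exact: lin_comp.
rewrite -(@coassoc _ _ _ _ coalgD _ x (fun a b c => g (a |> beta b (f c)))); last first.
  by apply: trilinI => ? ?; apply: (lin_comp (f := g)) => //; multilin.
under eq_sw => u c do rewrite -(lin_sw (f := g)) // harp_betaK linZ //.
exact: (counitl coalgD).
Qed.

Lemma beta_harp_lin (W : lmodType K) x (f : H -> H) (g : H -> W) : lin f -> lin g ->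
  \D_(a, r <- x) \D_(b, c <- r) g (beta a (b |> f c)) = g (f x).
Proof.
move=> lf lg; have lgf : lin (fun c => g (f c)) by exact: lin_comp.
rewrite -(@coassoc _ _ _ _ coalgD _ x (fun a b c => g (beta a (b |> f c)))); last first.
  by apply: trilinI => ? ?; apply: (lin_comp (f := g)) => //; multilin.
under eq_sw => u c do rewrite -(lin_sw (f := g)) // beta_harpK linZ //.
exact: (counitl coalgD).
Qed.

(** Unfolding both definitions gives [x_1 (x_2 |> beta x_3 (S x_4))], which (P3) reduces to
    [x_1 S x_2]. *)
Lemma bullet_sharp x : \D_(a, b <- x) a ** T b = eps x *: 1.
Proof.
sw (apply: (lin_bullet _ _ (f := id))).
sw (apply: (coassoc coalgD)).
under eq_sw => a r do under eq_sw => b s do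
  rewrite (lin_sharpE _ (f := fun u => a * (b |> u))) //.
under eq_sw => a r do rewrite (harp_beta_lin _ (g := *%R a)) //.
exact: mul_antipode.
Qed.

Lemma bullet_sharp_end (W : lmodType K) x (G : H -> H -> W) : bilin G ->
  \D_(c, r <- x) \D_(a, b <- r) G c (a ** T b) = G x 1.
Proof.
by apply: (@cancel_end _ _ _ _ coalgD _ (fun a b => a ** T b)); [multilin | exact: bullet_sharp].
Qed.

Lemma bullet_sharp_front (W : lmodType K) x (G : H -> H -> W) : bilin G ->
  \D_(a, r <- x) \D_(b, c <- r) G (a ** T b) c = G 1 x.
Proof.
by apply: (@cancel_front _ _ _ _ coalgD _ (fun a b => a ** T b)); [multilin | exact: bullet_sharp].
Qed.

(** Evaluate [beta x_1 (x_2 |> T x_3 |> y)] twice: (P3) leaves [T x |> y], whereas (P2) and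
    [bullet_sharp] leave [beta x (1 |> y)]. *)
Lemma harp_sharp x y : T x |> y = beta x y.
Proof.
transitivity (\D_(a, r <- x) \D_(b, c <- r) beta a (b |> T c |> y)).
  by symmetry; apply: (beta_harp_lin _ (f := fun c => T c |> y) (g := id)); multilin.
under eq_sw => a r do under eq_sw => b c do rewrite harp_harp.
rewrite (bullet_sharp_end _ (G := fun a u => beta a (u |> y))) //.
by rewrite harp1x.
Qed.

Lemma eps_sharp x : eps (T x) = eps x.
Proof.
have lf : lin (V := H) (W := K^o) eps by exact: linform_eps.
have := congr1 eps (bullet_sharp x).
rewrite (linZ (f := eps : H -> K^o)) // eps1 /GRing.scale /= mulr1 => <-.
rewrite [RHS](lin_sw _ _ _ lf); under eq_sw => a b do rewrite eps_bullet.
symmetry; apply: (@counitl _ _ _ _ coalgD K^o x (fun b => eps (T b))).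
exact: lin_comp lin_sharp.
Qed.

Lemma sharp1 : T 1 = 1.
Proof.
have := bullet_sharp 1; rewrite sw1 //.
by rewrite eps1 scale1r bullet1x.
Qed.

Lemma sharp_bullet x : \D_(a, b <- x) T a ** b = eps x *: 1.
Proof.
sw (apply: (lin_bullet _ _ (f := id))).
sw (apply: sw_sharp).
sw (apply: (coassoc coalgD)).
under eq_sw => c r do under eq_sw => d b do
  rewrite (lin_sharpE _ (f := fun u => u * (T c |> b))) //.
sw (apply: (coassoc coalgD)).
(* The target [eps x 1] is traded for [T x |> 1], to be expanded from its own end by [1 = S x_2 x_3]
   under the counit and (P1). *)
rewrite -eps_sharp -harpx1; symmetry.
transitivity (\D_(g, s <- x) \D_(f, b <- s) (T g |> (S f * b))).
  symmetry; apply: (@cancel_end _ _ _ _ coalgD _ (fun f b => S f * b) 1 x (fun g u => T g |> u)) => //.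
  exact: antipode_mul.
under eq_sw => g s do under eq_sw => f b do rewrite harpM.
swi (apply: sw_sharp).
swi (apply: sw_exchange).
sw (apply: (coassoc coalgD)).
do 3!apply: eq_sw => ? ?.
by rewrite harp_sharp.
Qed.

(** Uniqueness of convolution inverses for maps from the coalgebra of pairs: one side is a left
    inverse of [x ** y], the other a right inverse, and both are compared with the triple
    product. *)
Lemma sharpM x y : T (x ** y) = T y ** T x.
Proof.
transitivity (\D_(a, r <- x) \D_(b, c <- r) \D_(d, s <- y) \D_(e, f <- s)
   T (a ** d) ** (b ** e) ** (T f ** T c)).
  rewrite -[LHS]bulletx1.
  rewrite -(bullet_sharp_end x (G := fun a u => T (a ** y) ** u)) //.
  apply: eq_sw => a r; apply: eq_sw => b c.
  rewrite -[in LHS](bullet1x (T c)).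
  rewrite -(bullet_sharp_end y (G := fun d u => T (a ** d) ** (b ** (u ** T c)))) //.
  by apply: eq_sw => d s; apply: eq_sw => e f; rewrite !bulletA.
rewrite -(@coassoc _ _ _ _ coalgD _ x (fun a b c => \D_(d, s <- y) \D_(e, f <- s)
   T (a ** d) ** (b ** e) ** (T f ** T c))) //.
transitivity (\D_(p, c <- x) \D_(q, f <- y) (eps p * eps q) *: (T f ** T c)).
  apply: eq_sw => p c.
  under eq_sw => a b do
    rewrite -(@coassoc _ _ _ _ coalgD _ y (fun d e f =>
      T (a ** d) ** (b ** e) ** (T f ** T c))) //.
  rewrite sw_exchange; apply: eq_sw => q f.
  rewrite -(@sw_bullet _ _ _ (fun u v => T u ** v ** (T f ** T c))) //.
  rewrite -(lin_sw (f := fun u => u ** (T f ** T c))) //.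
  rewrite sharp_bullet (linZ (f := fun u => u ** (T f ** T c))) //.
  by rewrite eps_bullet bullet1x.
under eq_sw => p c do under eq_sw => q f do rewrite -scalerA.
under eq_sw => p c.
  rewrite -(lin_sw (f := *:%R (eps p))); last by apply: lin_scale; exact: lin_id.
  rewrite (@counitl _ _ _ _ coalgD _ _ (fun f => T f ** T c)) //.
  over.
by apply: (@counitl _ _ _ _ coalgD _ _ (fun c => T y ** T c)); multilin.
Qed.

(** * The adjoint coaction *)

Lemma sw_Ad (W : lmodType K) x (F : H -> H -> W) : bilin F ->
  sw Ad x F = \D_(a, r <- x) \D_(b, c <- r) F (a ** T c) b.
Proof.
move=> bF; rewrite /AdL /sw3 [LHS]big_map big_allpairs_dep.
by apply: (@coassoc _ _ _ _ coalgD _ _ (fun a b c => F (a ** T c) b)); multilin.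
Qed.

Lemma lincomulI (D' : H -> seq (H * H)) :
  (forall (W : lmodType K) (F : H -> H -> W), bilin F -> lin (fun x => sw D' x F)) -> lincomul D'.
Proof.
move=> lD a u v W F bF; rewrite [LHS](lD _ _ bF) big_cat big_map /= scaler_sumr.
congr (_ + _); apply: eq_bigr => p _.
by rewrite (linZ (f := F^~ p.2)) // => b w w'; apply: bF.1.
Qed.

Lemma lincomul_Ad : lincomul Ad.
Proof.
apply: lincomulI => W F bF a u v; rewrite !sw_Ad //.
by apply: (_ : lin (fun x => \D_(a, r <- x) \D_(b, c <- r) F (a ** T c) b)); multilin.
Qed.
#[local] Hint Resolve lincomul_Ad : multilinear.

(** * Sweedler calculus on pairs and the Yetter-Drinfeld compatibility *)

Lemma sharp_bullet_front (W : lmodType K) x (G : H -> H -> W) : bilin G ->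
  \D_(a, r <- x) \D_(b, c <- r) G (T a ** b) c = G 1 x.
Proof.
by apply: (@cancel_front _ _ _ _ coalgD _ (fun a b => T a ** b)); [multilin | exact: sharp_bullet].
Qed.

(** This is coassociativity of the tensor product coalgebra on pairs; primed letters come from
    [y]. *)
Lemma coassoc2 (W : lmodType K) x y (G : H -> H -> H -> H -> H -> H -> W) :
  (forall a' b' c', trilin (fun a b c => G a a' b b' c c')) ->
  (forall a b c, trilin (fun a' b' c' => G a a' b b' c c')) ->
  \DD_(p, p'; c, c' <- x, y) \DD_(a, a'; b, b' <- p, p') G a a' b b' c c' =
  \DD_(a, a'; r, r' <- x, y) \DD_(b, b'; c, c' <- r, r') G a a' b b' c c'.
Proof.
move=> tG tG'.
under eq_sw => p c do rewrite sw_exchange.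
under eq_sw => p c do under eq_sw => a b do
  rewrite (@coassoc _ _ _ _ coalgD _ _ (fun a' b' c' => G a a' b b' c c')) //.
rewrite (@coassoc _ _ _ _ coalgD _ _ (fun a b c => \D_(a', r' <- y) \D_(b', c' <- r') G a a' b b' c c')).
  by apply: eq_sw => a r; rewrite sw_exchange.
by apply: trilinI => u w; apply: lin_inner => a' r'; apply: lin_inner => b' c';
  case: (tG a' b' c') => l1 l2 l3; first [exact: l1 | exact: l2 | exact: l3].
Qed.

Lemma counitl2 (W : lmodType K) x y (F : H -> H -> W) : bilin F ->
  \DD_(a, a'; b, b' <- x, y) (eps a * eps a') *: F b b' = F x y.
Proof.
move=> bF; under eq_sw => a b.
  under eq_sw => a' b' do rewrite -scalerA.
  rewrite -(lin_sw (f := *:%R (eps a))); last by apply: lin_scale; exact: lin_id.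
  rewrite (@counitl _ _ _ _ coalgD _ _ (F b)) //.
  over.
by apply: (@counitl _ _ _ _ coalgD _ _ (fun b => F b y)).
Qed.

Lemma counitr2 (W : lmodType K) x y (F : H -> H -> W) : bilin F ->
  \DD_(a, a'; b, b' <- x, y) (eps b * eps b') *: F a a' = F x y.
Proof.
move=> bF; under eq_sw => a b.
  under eq_sw => a' b' do rewrite -scalerA.
  rewrite -(lin_sw (f := *:%R (eps b))); last by apply: lin_scale; exact: lin_id.
  rewrite (@counitr _ _ _ _ coalgD _ _ (F a)) //.
  over.
by apply: (@counitr _ _ _ _ coalgD _ _ (fun a => F a y)).
Qed.

Lemma bilin_lharp : bilin (lharp D S harp beta).
Proof.
by rewrite -[lharp D S harp beta]/(fun x y => \DD_(a, a'; b, b' <- x, y) T (a |> a') ** b ** b').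
Qed.
#[local] Hint Resolve bilin_lharp : multilinear.

Lemma lin_lharp (W : lmodType K) (f : H -> W) x y : lin f ->
  f (x <| y) = \DD_(a, a'; b, b' <- x, y) f (T (a |> a') ** b ** b').
Proof.
move=> lf; rewrite -[x <| y]/(\DD_(a, a'; b, b' <- x, y) T (a |> a') ** b ** b') lin_sw //.
by apply: eq_sw => a b; rewrite lin_sw.
Qed.

(** Unfolding [<|] gives [(x_1 |> y_1) ** T (x_2 |> y_2) ** x_3 ** y_3]; since [|>] is a coalgebra
    map, the first two factors are an antipode pair for [x_1 |> y_1] and cancel. *)
Lemma bullet_harp_lharp x y : x ** y = \DD_(a, a'; b, b' <- x, y) (a |> a') ** (b <| b').
Proof.
under eq_sw => a b do under eq_sw => a' b' do rewrite (lin_lharp _ _ (f := fun u => (a |> a') ** u)) //.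
rewrite -(@coassoc2 _ _ _ (fun a a' g g' k k' => (a |> a') ** (T (g |> g') ** k ** k'))) //.
symmetry; rewrite -[RHS](@counitl2 _ _ _ (bullet D harp)) //.
apply: eq_sw => p k; apply: eq_sw => p' k'.
under eq_sw => a b do under eq_sw => a' b' do rewrite -(bulletA (T _)) bulletA.
rewrite -(@sw_harp _ _ _ (fun u w => u ** T w ** (k ** k'))) //.
rewrite -(lin_sw (f := fun u => u ** (k ** k'))) // bullet_sharp.
by rewrite (linZ (f := fun u => u ** (k ** k'))) // bullet1x eps_harp.
Qed.

Lemma lin_bullet_lharp (W : lmodType K) (f : H -> W) x y : lin f ->
  f (x ** y) = \DD_(a, a'; b, b' <- x, y) f ((a |> a') ** (b <| b')).
Proof.
by move=> lf; rewrite bullet_harp_lharp lin_sw //; apply: eq_sw => a b; rewrite lin_sw.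
Qed.

Lemma bullet_sharp2 (W : lmodType K) x y (G : H -> H -> H -> W) : trilin G ->
  \DD_(g, g'; t, t' <- x, y) \DD_(k, k'; c, c' <- t, t') G g g' (k ** k' ** T (c ** c')) =
  G x y 1.
Proof.
move=> tG; rewrite -[RHS](@counitr2 _ _ _ (fun g g' => G g g' 1)) //.
apply: eq_sw => g t; apply: eq_sw => g' t'.
rewrite -(@sw_bullet _ _ _ (fun u w => G g g' (u ** T w))) //.
by rewrite -(lin_sw (f := G g g')) // bullet_sharp (linZ (f := G g g')) // eps_bullet.
Qed.

Lemma sw_Ad_harp (W : lmodType K) h v (F : H -> H -> W) : bilin F ->
  sw Ad (h |> v) F =
  \D_(a, r <- h) \D_(b, c <- r) sw Ad v (fun p q => F (a ** p ** T c) (b |> q)).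
Proof.
move=> bF.
transitivity (\DD_(a, a'; r, r' <- h, v) \DD_(b, b'; c, c' <- r, r')
    F ((a |> a') ** T (c |> c')) (b |> b')).
  rewrite sw_Ad // sw_harp //.
  by apply: eq_sw => a r; apply: eq_sw => a' r'; rewrite sw_harp.
(* The target is brought to the form [(h_1 ** v_1) ** T (h_3 ** v_3) (x) h_2 |> v_2], using that [T]
   reverses products. *)
transitivity (\DD_(a, a'; r, r' <- h, v) \DD_(b, b'; c, c' <- r, r')
    F (a ** a' ** T (c ** c')) (b |> b')); last first.
  apply: eq_sw => a r; under [RHS]eq_sw => b c do rewrite sw_Ad //.
  rewrite sw_exchange; apply: eq_sw => b c; apply: eq_sw => a' r'; apply: eq_sw => b' c'.
  by rewrite sharpM !bulletA.
symmetry.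
under eq_sw => a r do under eq_sw => a' r' do
  rewrite (lin_bullet_lharp _ _ (f := fun u => \DD_(b, b'; c, c' <- r, r')
    F (u ** T (c ** c')) (b |> b'))) //.
rewrite (@coassoc2 _ _ _ (fun e e' f f' r r' => \DD_(b, b'; c, c' <- r, r')
    F ((e |> e') ** (f <| f') ** T (c ** c')) (b |> b'))) //.
apply: eq_sw => e r; apply: eq_sw => e' r'.
rewrite -(@coassoc2 _ _ _ (fun f f' b b' c c' =>
    F ((e |> e') ** (f <| f') ** T (c ** c')) (b |> b'))) //.
(* Regrouping has made [f <| f'] and [b |> b'] the two halves of one coproduct, so (P6) exchanges
   their indices. *)
under eq_sw => p c do under eq_sw => p' c' do
  rewrite -(@sw_harp_lharp _ _ _ (fun u w => F ((e |> e') ** w ** T (c ** c')) u)) //.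
rewrite (@coassoc2 _ _ _ (fun f f' b b' c c' =>
    F ((e |> e') ** (b <| b') ** T (c ** c')) (f |> f'))) //.
apply: eq_sw => f s; apply: eq_sw => f' s'.
(* Unfolding [b <| b'] ends in [k ** k'], which cancels against the adjacent [T (c ** c')]; only
   [T (g |> g')] survives. *)
under eq_sw => b c do under eq_sw => b' c' do
  rewrite (lin_lharp _ _ (f := fun u => F ((e |> e') ** u ** T (c ** c')) (f |> f'))) //.
rewrite (@coassoc2 _ _ _ (fun g g' k k' c c' =>
  F ((e |> e') ** (T (g |> g') ** k ** k') ** T (c ** c')) (f |> f'))) //.
under eq_sw => g t do under eq_sw => g' t' do under eq_sw => k c do under eq_sw => k' c' do
  rewrite -(bulletA (e |> e')) -(bulletA (T _)) -(bulletA (T _)).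
rewrite (@bullet_sharp2 _ _ _ (fun g g' u => F ((e |> e') ** (T (g |> g') ** u)) (f |> f'))) //.
by rewrite bulletx1.
Qed.

(** * Comodule axioms and compatibility of the structure maps with action and coaction *)

Lemma sw_Ad_bullet (W : lmodType K) x y (F : H -> H -> W) : bilin F ->
  sw Ad (x ** y) F =
  \D_(a, r <- x) \D_(b, c <- r) sw Ad y (fun p q => F (a ** p ** T c) (b ** q)).
Proof.
move=> bF; rewrite sw_Ad // sw_bullet //.
apply: eq_sw => a r; under [RHS]eq_sw => b c do rewrite sw_Ad //.
rewrite [RHS]sw_exchange; apply: eq_sw => a' r'.
rewrite sw_bullet //; apply: eq_sw => b c; apply: eq_sw => b' c'.
by rewrite sharpM !bulletA.
Qed.

(** Both sides are [x_1 ** T x_5 (x) x_2 ** T x_4 (x) x_3], as [T] reverses the coproduct. *)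
Lemma Ad_coassoc (W : lmodType K) x (F : H -> H -> H -> W) : trilin F ->
  sw Ad x (fun r s => sw D r (fun p q => F p q s)) =
  sw Ad x (fun r s => sw Ad s (fun p q => F r p q)).
Proof.
move=> tF; rewrite !sw_Ad //.
transitivity (\D_(p, r <- x) \D_(q, s <- r) \D_(b, c <- s) \D_(d, e <- c)
    F (p ** T e) (q ** T d) b).
  under eq_sw => a r.
    under eq_sw => b c.
      rewrite sw_bullet //; under eq_sw => p q do rewrite sw_sharp //.
      over.
    rewrite sw_exchange; over.
  by sw (apply: (coassoc coalgD)).
symmetry.
under eq_sw => a r do under eq_sw => b c do rewrite sw_Ad //.
by do 2!swi (apply: (coassoc coalgD)).
Qed.

Lemma Ad_counit x : sw Ad x (fun r s => eps r *: s) = x.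
Proof.
rewrite sw_Ad //.
under eq_sw => a r.
  under eq_sw => b c do rewrite eps_bullet eps_sharp -scalerA.
  rewrite -(lin_sw (f := *:%R (eps a))); last by apply: lin_scale; exact: lin_id.
  rewrite (counitr coalgD) //.
  over.
exact: (counitl coalgD).
Qed.

(** Recovers the original product from [**], since [x_2 |> T x_3 |> y = (x_2 ** T x_3) |> y]. It
    reduces the coaction on products to [sw_Ad_bullet] and [sw_Ad_harp]. *)
Lemma mul_bullet x y : x * y = \D_(a, b <- x) a ** (T b |> y).
Proof.
symmetry; sw (apply: (lin_bullet (f := id))).
sw (apply: (coassoc coalgD)).
under eq_sw => a r do under eq_sw => b c do rewrite harp_harp.
by rewrite (bullet_sharp_end _ (G := fun a u => a * (u |> y))) // harp1x.
Qed.

Lemma sw_Ad_mul (W : lmodType K) x y (F : H -> H -> W) : bilin F ->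
  sw Ad (x * y) F = sw Ad x (fun p q => sw Ad y (fun s t => F (p ** s) (q * t))).
Proof.
move=> bF; rewrite mul_bullet [LHS](lin_sw (f := fun z => sw Ad z F)) //.
under eq_sw => a b do rewrite sw_Ad_bullet //.
under eq_sw => a b do under eq_sw => a1 r do under eq_sw => a2 a3 do
  rewrite sw_Ad_harp // sw_sharp //.
under eq_sw => a b do under eq_sw => a1 r do under eq_sw => a2 a3 do under eq_sw => s b1 do
  rewrite sw_sharp //.
do 2!sw (apply: (coassoc coalgD)).
swi (apply: (coassoc coalgD)).
rewrite [RHS]sw_Ad //.
apply: eq_sw => a1 r.
transitivity (\D_(a2, s <- r) \D_(b2, b1 <- s) sw Ad y (fun p q =>
   F (a1 ** (T b1 ** p)) (a2 ** (T b2 |> q)))).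
  apply: eq_sw => a2 s.
  (* Here [T (T b3) ** T a3 = T (a3 ** T b3)] with [a3], [b3] adjacent, so the factor collapses to
     [T 1 = 1]. *)
  under eq_sw => a3 t do under eq_sw => b3 w do under eq_sw => b2 b1 do under eq_sw => p q do
    rewrite -(bulletA a1) -(bulletA (T b1 ** p)) -sharpM.
  rewrite (@bullet_sharp_front _ s (fun u w => \D_(b2, b1 <- w) sw Ad y (fun p q =>
    F (a1 ** (T b1 ** p ** T u)) (a2 ** (T b2 |> q))))) //.
  by rewrite sharp1; do 2!apply: eq_sw => ? ?; rewrite bulletx1.
symmetry.
under eq_sw => b c do under eq_sw => p q do
  rewrite mul_bullet (lin_sw (f := F _)) //.
under eq_sw => b c do rewrite sw_exchange.
sw (apply: (coassoc coalgD)).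
by do 3!apply: eq_sw => ? ?; rewrite bulletA.
Qed.

Lemma sw_Ad1 (W : lmodType K) (F : H -> H -> W) : bilin F -> sw Ad 1 F = F 1 1.
Proof. by move=> bF; rewrite sw_Ad // !sw1 // sharp1 bulletx1. Qed.

(** On the right the first leg is [x_1 ** T x_3 ** x_4 ** T x_6], whose inner pair cancels. *)
Lemma Ad_comul (W : lmodType K) x (F : H -> H -> H -> W) : trilin F ->
  sw Ad x (fun r s => sw D s (fun p q => F r p q)) =
  \D_(u, v <- x) sw Ad u (fun p q => sw Ad v (fun s t => F (p ** s) q t)).
Proof.
move=> tF; rewrite sw_Ad //.
sw (apply: (coassoc coalgD)).
symmetry; under eq_sw => u v.
  rewrite sw_Ad //; under eq_sw => a r do under eq_sw => b c do rewrite sw_Ad //.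
  over.
do 2!sw (apply: (coassoc coalgD)).
apply: eq_sw => a r; apply: eq_sw => b s.
under eq_sw => c t do under eq_sw => d w do under eq_sw => e f do
  rewrite bulletA -(bulletA a).
rewrite (@sharp_bullet_front _ _ (fun u w => \D_(e, f <- w) F (a ** u ** T f) b e)) //.
by apply: eq_sw => e f; rewrite bulletx1.
Qed.

Lemma Ad_eps x : sw Ad x (fun r s => eps s *: r) = eps x *: 1.
Proof.
rewrite sw_Ad //.
under eq_sw => a r do rewrite (@counitl _ _ _ _ coalgD _ _ (fun c => a ** T c)) //.
exact: bullet_sharp.
Qed.

(** As [x_2 |> beta x_4 y = (x_2 ** T x_4) |> y], the twist in (P5) is the action of the first leg
    of [Ad]. *)
Lemma sw_mul_braided (W : lmodType K) x y (F : H -> H -> W) : bilin F ->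
  sw D (x * y) F = \D_(a, b <- x) \D_(c, d <- y)
    sw Ad b (fun p q => F (a * (p |> c)) (q * d)).
Proof.
move=> bF; rewrite sw_mul //; apply: eq_sw => a r.
under [RHS]eq_sw => c d do rewrite sw_Ad //.
rewrite [RHS]sw_exchange; apply: eq_sw => b s; rewrite [RHS]sw_exchange.
do 2!apply: eq_sw => ? ?; by rewrite -harp_harp harp_sharp.
Qed.

(** The two sides are a left and a right convolution inverse of [|>] on pairs: the left one because
    [|>] is a coalgebra map, the right one by (P1). *)
Lemma antipode_harp h x : S (h |> x) = h |> S x.
Proof.
transitivity (\DD_(p, p'; r, r' <- h, x) \DD_(q, q'; t, t' <- r, r')
    S (p |> p') * ((q |> q') * (t |> S t'))).
  rewrite -[LHS]mulr1 -[LHS](@counitr2 _ _ _ (fun p p' => S (p |> p') * 1)) //.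
  apply: eq_sw => p r; apply: eq_sw => p' r'.
  rewrite sw_exchange; under eq_sw => q' t'.
    rewrite -(lin_sw (f := *%R (S (p |> p')))) // -harpM; over.
  rewrite -(lin_sw (f := fun u => S (p |> p') * (r |> u))) // mul_antipode.
  by rewrite (linZ (f := fun u => S (p |> p') * (r |> u))) // harpx1 -scalerAr scalerA mulrC.
rewrite -(@coassoc2 _ _ _ (fun p p' q q' t t' => S (p |> p') * ((q |> q') * (t |> S t')))) //.
rewrite -[RHS](@counitl2 _ _ _ (fun t t' => t |> S t')) //.
apply: eq_sw => p t; apply: eq_sw => p' t'.
under eq_sw => a b do under eq_sw => a' b' do rewrite mulrA.
rewrite -(@sw_harp _ _ _ (fun u w => S u * w * (t |> S t'))) //.
rewrite -(lin_sw (f := *%R^~ (t |> S t'))) // antipode_mul.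
by rewrite (linZ (f := *%R^~ (t |> S t'))) // mul1r eps_harp.
Qed.

(** Convolve maps from [H] into the tensor product of [H] under [**] with [H] under [*]. There [Ad]
    followed by [S] on the second leg is a left inverse of [Ad], by [Ad_comul], and [S] followed by
    [Ad] is a right inverse, by [sw_Ad_mul]. *)
Lemma Ad_antipode (W : lmodType K) x (F : H -> H -> W) : bilin F ->
  sw Ad (S x) F = sw Ad x (fun r s => F r (S s)).
Proof.
move=> bF; symmetry.
transitivity (\D_(a, r <- x) \D_(b, c <- r) sw Ad a (fun p q => sw Ad b (fun s t =>
   sw Ad (S c) (fun u v => F (p ** (s ** u)) (S q * (t * v)))))).
  rewrite -[LHS](@counitr _ _ _ _ coalgD _ _ (fun a => sw Ad a (fun r s => F r (S s)))) //.
  apply: eq_sw => a r; rewrite [RHS]sw_exchange.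
  rewrite (lin_sw (f := *:%R (eps r))); last by apply: lin_scale; exact: lin_id.
  apply: eq_sw => p q.
  under [RHS]eq_sw => b c do rewrite -(@sw_Ad_mul _ _ _ (fun u v => F (p ** u) (S q * v))) //.
  pose G z := sw Ad z (fun u v => F (p ** u) (S q * v)); have lG : lin G by rewrite /G.
  by rewrite -[RHS](lin_sw (f := G)) // mul_antipode linZ // /G sw_Ad1 // bulletx1 mulr1.
rewrite -(@coassoc _ _ _ _ coalgD _ _ (fun a b c => sw Ad a (fun p q => sw Ad b (fun s t =>
   sw Ad (S c) (fun u v => F (p ** (s ** u)) (S q * (t * v))))))) //.
rewrite -[RHS](@counitl _ _ _ _ coalgD _ _ (fun c => sw Ad (S c) F)) //.
apply: eq_sw => w c.
pose G p q t := sw Ad (S c) (fun u v => F (p ** u) (S q * t * v)).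
have tG : trilin G by rewrite /G.
transitivity (\D_(a, b <- w) sw Ad a (fun p q => sw Ad b (fun s t => G (p ** s) q t))).
  do 4!apply: eq_sw => ? ?.
  by rewrite bulletA mulrA.
(* Two coactions become one followed by the coproduct of its second leg, where [S q * t]
   collapses. *)
rewrite -Ad_comul //.
pose G' r := sw Ad (S c) (fun u v => F (r ** u) v); have lG' : lin G' by rewrite /G'.
transitivity (sw Ad w (fun r s => eps s *: G' r)).
  apply: eq_sw => r s; rewrite /G /G' sw_exchange.
  rewrite (lin_sw (f := *:%R (eps s))); last by apply: lin_scale; exact: lin_id.
  apply: eq_sw => u v.
  rewrite -(lin_sw (f := fun z => F (r ** u) (z * v))) // antipode_mul.
  by rewrite (linZ (f := fun z => F (r ** u) (z * v))) // mul1r.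
transitivity (G' (sw Ad w (fun r s => eps s *: r))).
  by rewrite lin_sw //; apply: eq_sw => r s; rewrite linZ.
rewrite Ad_eps linZ // /G'.
by congr (_ *: _); apply: eq_sw => u v; rewrite bullet1x.
Qed.

(** * Assembly of the module, the Hopf monoid and the braiding *)

Lemma yd_module_Ad : yd_module (bullet D harp) 1 D eps T harp Ad.
Proof.
split; first split.
- exact: bilin_harp.
- by move=> h g v; rewrite harp_harp.
- exact: harp1x.
- split; first exact: lincomul_Ad.
  + by move=> v W f tf; rewrite !big_allpairs_dep; apply: Ad_coassoc.
  + exact: Ad_counit.
- move=> h v W f bf; rewrite [LHS](sw_Ad_harp _ _ bf) big_allpairs_dep /sw3 big_allpairs_dep.
  by rewrite -(@coassoc _ _ _ _ coalgD _ _ (fun a b c => sw Ad v (fun p q =>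
    f (a ** p ** T c) (b |> q)))).
Qed.

Lemma yd_hopf_monoid_Ad :
  yd_hopf_monoid (bullet D harp) 1 D eps T harp Ad *%R 1 D eps S.
Proof.
split; [split | exact: coalgD | split | split | split; split].
- exact: bilin_mul.
- exact: mulrA.
- exact: mul1r.
- exact: mulr1.
- exact: harpM.
- exact: harpx1.
- by move=> h a W f bf; rewrite big_allpairs_dep; apply: sw_harp.
- exact: eps_harp.
- by move=> a b W f bf; rewrite big_allpairs_dep; apply: sw_Ad_mul.
- by move=> W f bf; rewrite big_seq1; apply: sw_Ad1.
- move=> a W f tf; rewrite big_allpairs_dep big_flatten big_map.
  under [RHS]eq_bigr => p _ do rewrite big_allpairs_dep.
  exact: Ad_comul.
- exact: Ad_eps.
- exact: epsM.
- exact: eps1.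
- by move=> W f bf; rewrite big_seq1; apply: sw1.
- move=> a b W f bf; rewrite big_flatten big_map.
  under [RHS]eq_bigr => p _.
    rewrite big_allpairs_dep; under eq_bigr => q _ do rewrite /braiding big_map.
    over.
  exact: sw_mul_braided.
- exact: lin_antipode.
- exact: antipode_harp.
- by move=> a W f bf; rewrite [RHS]big_map; apply: Ad_antipode.
- exact: mul_antipode.
- exact: antipode_mul.
Qed.

Lemma braiding_Ad x y :
  teq2 (braiding harp Ad x y) [seq (harp p.1.1 (beta p.2 y), p.1.2) | p <- sw3 D x].
Proof.
move=> W f bf; rewrite [LHS]big_map [RHS]big_map [RHS]big_allpairs_dep.
rewrite [LHS](@sw_Ad _ _ (fun r s => f (r |> y) s)) //.
rewrite [RHS](@coassoc _ _ _ _ coalgD _ _ (fun a b c => f (a |> beta c y) b)) //.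
by do 2!apply: eq_sw => ? ?; rewrite -harp_harp harp_sharp.
Qed.

End PostHopf.

Theorem theorem3 (K : fieldType) (H : algType K)
    (D : H -> seq (H * H)) (eps : H -> K) (S : H -> H) (harp beta : H -> H -> H) :
  yd_post_hopf D eps S harp beta ->
  yd_module (bullet D harp) 1 D eps (Sharp D S beta) harp (AdL D S harp beta) /\
  yd_hopf_monoid (bullet D harp) 1 D eps (Sharp D S beta) harp (AdL D S harp beta)
    *%R 1 D eps S /\
  (forall a b, teq2 (braiding harp (AdL D S harp beta) a b)
                    [seq (harp p.1.1 (beta p.2 b), p.1.2) | p <- sw3 D a]).
Proof.
move=> postH; split; first exact: yd_module_Ad.
split; first exact: yd_hopf_monoid_Ad.
exact: (braiding_Ad postH).
Qed.
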